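(* The elements $t_1t_2\cdots t_k$, for $k\in\{0,1,\dots,n\}$ (with the empty product equal to $1$ for $k=0$), form a complete set of representatives of the $\mathcal{B}_n$-orbits in the set of planar words of $\Sigma_{0,1,n}$. That is, every planar word lies in the $\mathcal{B}_n$-orbit of $t_1\cdots t_k$ for exactly one $k$.
   Context: $\Sigma_{0,1,n}$ is the free group on $t_1,\dots,t_n$, with $\overline t_k=t_k^{-1}$ and $z_1=(t_1\cdots t_n)^{-1}$. Automorphisms act on the right. $\mathcal{B}_n$ is the group of automorphisms of $\Sigma_{0,1,n}$ fixing $z_1$ and permuting the conjugacy classes $\{[t_1],\dots,[t_n]\}$; it acts on $\Sigma_{0,1,n}$ and preserves the set of planar words. Let $A$ be the set of formal symbols $\overline z_1,t_1,\overline t_1,\dots,t_n,\overline t_n,z_1$, ordered by $\overline z_1<t_1<\overline t_1<\dots<t_n<\overline t_n<z_1$. For a reduced word $a_1\cdots a_m$, its Whitehead expansion is $(c_1,\dots,c_{2m+2})=(\overline z_1,a_1,\overline a_1,\dots,a_m,\overline a_m,z_1)$. Two $2$-element sets of integers $\{a,b\},\{c,d\}$ are nested if $a,b,c,d$ are distinct and either both or neither of $c,d$ lie strictly between $a$ and $b$. A $2M$-tuple $(c_1,\dots,c_{2M})$ of elements of $A$ is planar if some permutation $\pi$ of $\{1,\dots,2M\}$ satisfies three conditions: - $\pi(i)<\pi(j)\Rightarrow c_i\le c_j$; - the sets $\{\pi(2i-1),\pi(2i)\}$, $1\le i\le M$, are pairwise nested; - the sets $\{\pi(2i),\pi(2i+1)\}$,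 $1\le i\le M-1$, are pairwise nested. A word $w$ is planar if the Whitehead expansion of its reduced word is planar. *)

(* Defs.v *)
From mathcomp Require Import all_boot all_fingroup.
Set Implicit Arguments. Unset Strict Implicit. Unset Printing Implicit Defensive.

(** * The free group Sigma_{0,1,n} on t_1..t_n, as reduced words.
    A letter (i, false) is t_{i+1}; (i, true) is its inverse tbar_{i+1}. *)
Definition letter (n : nat) := ('I_n * bool)%type.
Definition word (n : nat) := seq (letter n).

Definition linv {n} (x : letter n) : letter n := (x.1, ~~ x.2).

Definition push {n} (x : letter n) (w : word n) : word n :=
  if w is y :: w' then (if y == linv x then w' else x :: w) else [:: x].
Definition reduce {n} (w : word n) : word n := foldr push [::] w.

Fixpoint reduced {n} (w : word n) : bool :=
  if w is x :: w' then
    (if w' is y :: _ then y != linv x else true) && reduced w'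
  else true.

Definition wmul {n} (u v : word n) : word n := reduce (u ++ v).
Definition winv {n} (w : word n) : word n := rev (map linv w).

Definition gen {n} (i : 'I_n) : word n := [:: (i, false)].

Definition tprod (n k : nat) : word n := [seq (i, false) | i <- take k (enum 'I_n)].

Definition z1 (n : nat) : word n := winv (tprod n n).

Definition subst {n} (f : 'I_n -> word n) (w : word n) : word n :=
  reduce (flatten [seq (if l.2 then winv (f l.1) else f l.1) | l <- w]).

Definition conjugate {n} (u v : word n) : Prop :=
  exists c : word n, reduce (winv c ++ u ++ c) = v.

Definition is_aut {n} (f : 'I_n -> word n) : Prop :=
  exists g : 'I_n -> word n,
    (forall i, subst g (f i) = gen i) /\ (forall i, subst f (g i) = gen i).

Definition in_Bn {n} (f : 'I_n -> word n) : Prop :=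
  [/\ is_aut f,
      subst f (z1 n) = z1 n &
      exists s : {perm 'I_n}, forall i, conjugate (subst f (gen i)) (gen (s i))].

Definition in_Bn_orbit {n} (w v : word n) : Prop :=
  exists f : 'I_n -> word n, in_Bn f /\ subst f w = v.

(** * Whitehead expansion and planarity.
    Symbols of A are coded by naturals respecting the order:
    zbar_1 = 0, t_{j+1} = 2j+1, tbar_{j+1} = 2j+2, z_1 = 2n+1. *)
Definition code {n} (x : letter n) : nat :=
  if x.2 then (val x.1).*2.+2 else (val x.1).*2.+1.

Definition wh_exp {n} (w : word n) : seq nat :=
  0 :: flatten [seq [:: code a; code (linv a)] | a <- w] ++ [:: n.*2.+1].

Definition between (x a b : nat) : bool := (minn a b < x) && (x < maxn a b).

Definition nested (a b c d : nat) : bool :=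
  uniq [:: a; b; c; d] && (between c a b == between d a b).

(** planar tuple (c_1..c_{2M}); positions are 0-indexed here, and the
    permutation pi of {0..2M-1} is given as the list of its values. *)
Definition planar_seq (c : seq nat) : Prop :=
  let N := size c in let M := N %/ 2 in
  exists s : seq nat,
    let pi := fun i => nth 0 s i in
    [/\ perm_eq s (iota 0 N),
        (forall i j, i < N -> j < N -> pi i < pi j -> nth 0 c i <= nth 0 c j),
        (forall i j, i < M -> j < M -> i != j ->
           nested (pi i.*2) (pi i.*2.+1) (pi j.*2) (pi j.*2.+1)) &
        (forall i j, i.+1 < M -> j.+1 < M -> i != j ->
           nested (pi i.*2.+1) (pi i.*2.+2) (pi j.*2.+1) (pi j.*2.+2))].

Definition planar {n} (w : word n) : Prop := planar_seq (wh_exp (reduce w)).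

(* Main.v *)
Require Import Defs.
From HB Require Import structures.
From mathcomp Require Import all_boot all_fingroup zmodp zify.
Set Implicit Arguments. Unset Strict Implicit. Unset Printing Implicit Defensive.

(** Put n punctures on a horizontal line. A planar word describes a simple arc crossing the
    line: its points are the entries of the Whitehead expansion, the pairs
    {pi(2i-1), pi(2i)} are half-arcs above the line and the pairs {pi(2i), pi(2i+1)} are
    half-arcs below it. Labelling a point x by the number c x of punctures on its left, and
    writing P_k = t_1...t_k, the word is the product of the P_(c u)^-1 P_(c v) over the
    lower half-arcs (u, v). A braid may carry a puncture below a lower half-arc from one
    side of it to the other; this only changes the labels of the points between its ends.
    Take an innermost upper half-arc (p, q) which does not contain an end point of the arc:
    one of the two lower half-arcs at p and q leads away from the other point, and the
    punctures between p and q can be carried away below it. Then c p = c q, so P_(c p) and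
    P_(c q)^-1 cancel and the points p and q can be deleted. At the end at most one lower
    half-arc (x, y) remains, with x < y, and carrying the punctures left of x to the right
    of y turns the word into P_k. Finally k is the exponent sum, which braids preserve. *)

(** * The free group *)

Section FreeGroup.
Local Open Scope group_scope.
Variable n : nat.
Implicit Types (a b : letter n) (u v w : word n).

Lemma linvK : involutive (@linv n).
Proof. by case=> i s; rewrite /linv /= negbK. Qed.

Lemma winvK : involutive (@winv n).
Proof. by move=> w; rewrite /winv map_rev revK mapK //; apply: linvK. Qed.

Lemma reduced_push a w : reduced w -> reduced (push a w).
Proof.
case: w => [|b w] //= /andP[bw rw].
by case: eqP => //= /eqP-> /=; rewrite bw.
Qed.

Lemma reduced_reduce w : reduced (reduce w).
Proof. by elim: w => //= a w IHw; apply: reduced_push. Qed.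

Lemma reduce_id w : reduced w -> reduce w = w.
Proof.
elim: w => //= a w IHw /andP[aw rw]; rewrite IHw //.
by case: w aw {IHw rw} => //= b w /negPf->.
Qed.

Lemma pushK a w : reduced w -> push a (push (linv a) w) = w.
Proof.
case: w => [|b w] /=; first by rewrite eqxx.
case: eqP => [->|] /=; last by rewrite eqxx.
by rewrite !linvK; case: w => [|b' w] //= /andP[/negPf->].
Qed.

Lemma foldr_push_reduce w u : reduced w -> foldr push w (reduce u) = foldr push w u.
Proof.
move=> rw; elim: u => //= a u <-.
case: (reduce u) => [|b v] //=; case: eqP => //= ->.
by rewrite pushK //; elim: v => //= b' v; apply: reduced_push.
Qed.

Lemma reduce_cat u v : reduce (reduce u ++ reduce v) = reduce (u ++ v).
Proof.
rewrite /reduce !foldr_cat -!/(reduce _) reduce_id ?reduced_reduce //.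
by rewrite foldr_push_reduce ?reduced_reduce.
Qed.

Lemma reduce_winv_cat w : reduce (winv w ++ w) = [::].
Proof.
elim: w => // a w; rewrite /winv /= rev_cons cat_rcons -/(winv w) => <-.
rewrite /reduce !foldr_cat /= -!/(reduce _) -{2}(linvK a).
by rewrite pushK ?reduced_reduce.
Qed.

Record free_group := FreeGroup {fg_word :> seq (letter n); fg_reduced : reduced fg_word}.

HB.instance Definition _ := [isSub for fg_word].
HB.instance Definition _ := [Choice of free_group by <:].

Definition of_word w : free_group := FreeGroup (reduced_reduce w).

Lemma of_wordP u v : of_word u = of_word v <-> reduce u = reduce v.
Proof. by split=> [[]|uv] //; apply: val_inj. Qed.

Lemma fg_wordK : cancel fg_word of_word.
Proof. by move=> x; apply: val_inj; rewrite /= reduce_id ?fg_reduced. Qed.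

Lemma of_word_reduce w : of_word (reduce w) = of_word w.
Proof. exact: fg_wordK (of_word w). Qed.

Definition fg_mul (x y : free_group) : free_group := of_word (x ++ y).
Definition fg_inv (x : free_group) : free_group := of_word (winv x).

Fact of_word_cat u v : of_word (u ++ v) = fg_mul (of_word u) (of_word v).
Proof. by apply/of_wordP; rewrite reduce_cat. Qed.

Fact fg_mulgA : associative fg_mul.
Proof.
by move=> x y z; rewrite -[x]fg_wordK -[y]fg_wordK -[z]fg_wordK -!of_word_cat catA.
Qed.

Fact fg_mul1g : left_id (of_word [::]) fg_mul.
Proof. by move=> x; rewrite -[x]fg_wordK -of_word_cat. Qed.

Fact fg_mulg1 : right_id (of_word [::]) fg_mul.
Proof. by move=> x; rewrite -[x]fg_wordK -of_word_cat cats0. Qed.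

Fact fg_mulVg : left_inverse (of_word [::]) fg_inv fg_mul.
Proof.
move=> x; rewrite -{2}[x]fg_wordK -of_word_cat.
by apply/of_wordP; rewrite reduce_winv_cat.
Qed.

Fact fg_mulgV : right_inverse (of_word [::]) fg_inv fg_mul.
Proof.
move=> x; rewrite -{1}[x]fg_wordK -of_word_cat -{1}[fg_word x]winvK.
by apply/of_wordP; rewrite reduce_winv_cat.
Qed.

HB.instance Definition _ :=
  isGroup.Build free_group fg_mulgA fg_mul1g fg_mulg1 fg_mulVg fg_mulgV.

Lemma of_wordM u v : of_word (u ++ v) = of_word u * of_word v.
Proof. exact: of_word_cat. Qed.

Lemma of_word_prod w : of_word w = \prod_(a <- w) of_word [:: a].
Proof. by elim: w => [|a w IHw]; rewrite ?big_nil // big_cons -IHw -of_wordM. Qed.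

Lemma of_wordV w : of_word (winv w) = (of_word w)^-1.
Proof.
apply/eqP; rewrite -mulg_eq1 -of_wordM.
by apply/eqP/of_wordP; rewrite reduce_winv_cat.
Qed.

Definition fgen (i : 'I_n) : free_group := of_word (gen i).

Section Lift.
Variables (G : groupType) (f : 'I_n -> G).

Definition eval_letter a : G := if a.2 then (f a.1)^-1 else f a.1.
Definition eval_word w : G := \prod_(a <- w) eval_letter a.

Lemma eval_word_reduce w : eval_word (reduce w) = eval_word w.
Proof.
have eval_push a u : eval_word (push a u) = eval_letter a * eval_word u.
  rewrite /eval_word; case: u => [|b u] /=; first by rewrite big_seq1 big_nil mulg1.
  case: eqP => [->|_]; rewrite !big_cons // mulgA.
  by rewrite /eval_letter /=; case: a.2; rewrite ?mulgV ?mulVg mul1g.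
by elim: w => //= a w IHw; rewrite eval_push IHw /eval_word big_cons.
Qed.

Definition fg_lift (x : free_group) : G := eval_word x.

Lemma fg_lift_of_word w : fg_lift (of_word w) = eval_word w.
Proof. exact: eval_word_reduce. Qed.

Fact fg_lift_is_monoid_morphism : monoid_morphism fg_lift.
Proof.
split=> [|x y]; first by rewrite /fg_lift /eval_word big_nil.
by rewrite -[x]fg_wordK -[y]fg_wordK -of_wordM !fg_lift_of_word /eval_word big_cat.
Qed.

HB.instance Definition _ :=
  isUMagmaMorphism.Build free_group G fg_lift fg_lift_is_monoid_morphism.

Lemma fg_lift_fgen i : fg_lift (fgen i) = f i.
Proof. by rewrite fg_lift_of_word /eval_word big_seq1. Qed.
End Lift.

Lemma eval_word_fgen w : eval_word fgen w = of_word w.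
Proof.
elim: w => [|[i s] w IHw]; first by rewrite /eval_word big_nil.
rewrite /eval_word big_cons -/(eval_word _ _) IHw -cat1s of_wordM /eval_letter.
by case: s; rewrite //= -of_wordV.
Qed.

Lemma eq_fg_morph (G : groupType) (phi psi : UMagmaMorphism.type free_group G) :
  (forall i, phi (fgen i) = psi (fgen i)) -> phi =1 psi.
Proof.
move=> eq_gen x; rewrite -[x]fg_wordK -eval_word_fgen !gmulf_prod.
apply: eq_bigr => -[i s] _; rewrite /eval_letter.
by case: s; rewrite /= ?gmulfV eq_gen.
Qed.

Lemma fg_lift_id : fg_lift fgen =1 id.
Proof. by apply: (@eq_fg_morph _ (fg_lift fgen) idfun) => i; rewrite /= fg_lift_fgen. Qed.

Lemma eq_fg_lift (G : groupType) (f g : 'I_n -> G) : f =1 g -> fg_lift f =1 fg_lift g.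
Proof.
move=> fg; apply: (@eq_fg_morph _ (fg_lift f) (fg_lift g)) => i.
by rewrite /= !fg_lift_fgen.
Qed.

Lemma fg_lift_comp (G : groupType) (f : 'I_n -> G) (g : 'I_n -> free_group) x :
  fg_lift f (fg_lift g x) = fg_lift (fg_lift f \o g) x.
Proof.
move: x; apply: (@eq_fg_morph _ (fg_lift f \o fg_lift g) (fg_lift (fg_lift f \o g))) => i.
by rewrite /= !fg_lift_fgen.
Qed.
End FreeGroup.

Arguments of_word {n} w.
Arguments fgen {n} i.

(** * Braid automorphisms *)

Section Braids.
Local Open Scope group_scope.
Variable n : nat.
Implicit Types (f g : 'I_n -> free_group n) (x y z : free_group n) (u v w : word n).

Lemma fg_lift_cancel f g :
  (forall i, fg_lift g (f i) = fgen i) -> cancel (fg_lift f) (fg_lift g).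
Proof. by move=> gf x; rewrite fg_lift_comp (eq_fg_lift gf) fg_lift_id. Qed.

Lemma tprod_rcons k (lt_kn : k < n) :
  tprod n k.+1 = rcons (tprod n k) (Ordinal lt_kn, false).
Proof.
rewrite /tprod (take_nth (Ordinal lt_kn)) ?size_enum_ord // map_rcons.
by congr (rcons _ (_, _)); apply: val_inj; rewrite /= nth_enum_ord.
Qed.

Definition tprefix k : free_group n := of_word (tprod n k).

Lemma tprefix0 : tprefix 0 = 1.
Proof. by rewrite /tprefix /tprod take0. Qed.

Lemma tprefixS k (lt_kn : k < n) : tprefix k.+1 = tprefix k * fgen (Ordinal lt_kn).
Proof. by rewrite /tprefix tprod_rcons -cats1 of_wordM. Qed.

Definition automorphic f : Prop :=
  exists g, cancel (fg_lift f) (fg_lift g) /\ cancel (fg_lift g) (fg_lift f).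

Definition braid f : Prop :=
  [/\ automorphic f,
      fg_lift f (tprefix n) = tprefix n &
      exists s : {perm 'I_n}, forall i, exists c, f i ^ c = fgen (s i)].

Lemma braid_id : braid (@fgen n).
Proof.
split; last by exists 1 => i; exists 1; rewrite conjg1 perm1.
- by exists (@fgen n); split=> x; rewrite !fg_lift_id.
- by rewrite fg_lift_id.
Qed.

Lemma braid_comp f g : braid f -> braid g -> braid (fg_lift f \o g).
Proof.
move=> [[f' [f'f ff']] fP [s fs]] [[g' [g'g gg']] gP [t gt]]; split.
- exists (fg_lift g' \o f'); split=> x; rewrite -!fg_lift_comp /=.
  + by rewrite f'f g'g.
  + by rewrite gg' ff'.
- by rewrite -fg_lift_comp /= gP fP.
- exists (t * s) => i; have [c gc] := gt i; have [d fd] := fs (t i).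
  by exists (fg_lift f c * d); rewrite conjgM /= -gmulfJ gc /= fg_lift_fgen fd permM.
Qed.

Lemma braid_inv f : braid f -> exists2 g, braid g & cancel (fg_lift f) (fg_lift g).
Proof.
move=> [[g [gf fg]] fP [s fs]]; exists g => //; split; first by exists f.
- by rewrite -{1}fP gf.
- exists s^-1 => i; have [c fc] := fs (s^-1 i).
  exists (fg_lift g c)^-1; rewrite -[g i](fg_lift_fgen g) -{1}[i](permKV s) -fc.
  by rewrite gmulfJ -[f _](fg_lift_fgen f) /= gf conjgK.
Qed.

Definition braid_orbit x y : Prop := exists2 f, braid f & fg_lift f x = y.

Lemma braid_orbit_refl x : braid_orbit x x.
Proof. by exists (@fgen n); [apply: braid_id | rewrite fg_lift_id]. Qed.

Lemma braid_orbit_sym x y : braid_orbit x y -> braid_orbit y x.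
Proof. by case=> f /braid_inv[g bg gf] <-; exists g. Qed.

Lemma braid_orbit_trans y x z :
  braid_orbit x y -> braid_orbit y z -> braid_orbit x z.
Proof.
move=> [f bf <-] [g bg <-]; exists (fg_lift g \o f); first exact: braid_comp.
by rewrite -fg_lift_comp.
Qed.

Lemma reduced_same_sign b (s : seq 'I_n) : reduced [seq (i, b) | i <- s].
Proof.
by elim: s => //= i [|j s] //= ->; rewrite andbT xpair_eqE; case: b; rewrite andbF.
Qed.

Lemma reduced_tprod k : reduced (tprod n k).
Proof. exact: reduced_same_sign. Qed.

Lemma of_word_inj : {in @reduced n &, injective of_word}.
Proof. by move=> u v ru rv /of_wordP; rewrite !reduce_id. Qed.

Definition represents (F : 'I_n -> word n) f : Prop := forall i, of_word (F i) = f i.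

Lemma represents_fg_word f : represents (fun i => fg_word (f i)) f.
Proof. by move=> i; apply: fg_wordK. Qed.

Lemma of_word_subst F f w : represents F f -> of_word (subst F w) = fg_lift f (of_word w).
Proof.
move=> Ff; rewrite fg_lift_of_word /subst of_word_reduce /eval_word.
elim: w => [|[i s] w IHw]; first by rewrite big_nil.
rewrite big_cons /= of_wordM IHw /eval_letter /= -Ff.
by case: s; rewrite ?of_wordV.
Qed.

Lemma substP F f u v : represents F f -> reduced v ->
  subst F u = v <-> fg_lift f (of_word u) = of_word v.
Proof.
move=> Ff rv; rewrite -(of_word_subst _ Ff); split=> [-> //|/of_word_inj->] //.
exact: reduced_reduce.
Qed.

Lemma is_autP F f : represents F f -> is_aut F <-> automorphic f.
Proof.
move=> Ff; split=> -[].
- move=> G [GF FG]; have Gg : represents G (of_word \o G) by [].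
  exists (of_word \o G); split; apply: fg_lift_cancel => i.
  + by rewrite -Ff -(of_word_subst _ Gg) GF.
  + by rewrite /= -(of_word_subst _ Ff) FG.
- move=> g [gf fg]; exists (fun i => fg_word (g i)).
  have Gg := represents_fg_word g; split=> i.
  + by apply/(substP _ Gg) => //; rewrite Ff -[f i]fg_lift_fgen gf.
  + by apply/(substP _ Ff) => //; rewrite Gg -[g i]fg_lift_fgen fg.
Qed.

Lemma conjugateP u v : reduced v ->
  Defs.conjugate u v <-> exists c, of_word u ^ c = of_word v.
Proof.
move=> rv; have conjE c : of_word u ^ of_word c = of_word (winv c ++ u ++ c).
  by rewrite !of_wordM of_wordV.
split=> -[c uv]; first by exists (of_word c); rewrite conjE -uv of_word_reduce.
exists c; rewrite -[c]fg_wordK conjE in uv.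
by rewrite -(reduce_id rv); apply/of_wordP.
Qed.

Lemma in_BnP F f : represents F f -> in_Bn F <-> braid f.
Proof.
move=> Ff; have fixP : subst F (z1 n) = z1 n <-> fg_lift f (tprefix n) = tprefix n.
  have rz : reduced (z1 n).
    by rewrite /z1 /winv /tprod -map_comp -map_rev; apply: reduced_same_sign.
  rewrite (substP _ Ff rz) of_wordV -/(tprefix n) gmulfV /=.
  by split=> [/invg_inj|->].
have conjP i j : Defs.conjugate (subst F (gen i)) (gen j) <-> exists c, f i ^ c = fgen j.
  by rewrite conjugateP // (of_word_subst _ Ff) fg_lift_fgen.
split=> -[/(is_autP Ff) autF /fixP fP [s sP]]; split=> //; exists s => i; exact/conjP.
Qed.

Lemma in_Bn_orbitP u v : reduced v ->
  in_Bn_orbit u v <-> braid_orbit (of_word u) (of_word v).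
Proof.
move=> rv; split=> [[F [BF uv]]|[f bf uv]].
  have Ff : represents F (of_word \o F) by [].
  by exists (of_word \o F); [apply/(in_BnP Ff) | apply/(substP _ Ff rv)].
have Ff := represents_fg_word f.
by exists (fun i => fg_word (f i)); split; [apply/(in_BnP Ff) | apply/(substP _ Ff rv)].
Qed.
End Braids.

Section Degree.
Local Open Scope group_scope.
Variable n : nat.

(* Exponent sums modulo n + 1, which already separate t_1...t_k for 0 <= k <= n. *)
Definition degree : free_group n -> 'I_n.+1 := fg_lift (fun=> Zp1).

Lemma degree_tprefix k : k <= n -> degree (tprefix n k) = inord k.
Proof.
move=> kn; suff -> : degree (tprefix n k) = Zp1 ^+ k.
  by rewrite Zp_expg; apply: val_inj; rewrite /= inordK // modnMml mul1n modn_small.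
elim: k kn => [|k IHk] kn; first by rewrite tprefix0 [degree _]gmulf1.
by rewrite tprefixS [degree _]gmulfM /= fg_lift_fgen expgSr -IHk // ltnW.
Qed.

Lemma degree_braid f x : braid f -> degree (fg_lift f x) = degree x.
Proof.
move=> [_ _ [s fs]].
rewrite /degree fg_lift_comp; apply: eq_fg_lift => i /=.
have [c fc] := fs i; rewrite -[RHS](fg_lift_fgen (fun=> Zp1) (s i)) -fc gmulfJ /=.
by rewrite conjgE Zp_mulgC mulgK.
Qed.

Lemma tprefix_orbit_inj x k l : k <= n -> l <= n ->
  braid_orbit x (tprefix n k) -> braid_orbit x (tprefix n l) -> k = l.
Proof.
move=> kn ln [f bf fx] [g bg gx].
rewrite -(inordK (_ : k < n.+1)) // -[RHS](inordK (_ : l < n.+1)) //.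
by rewrite -!degree_tprefix // -fx -gx !degree_braid.
Qed.
End Degree.

Section ArtinGenerator.
Local Open Scope group_scope.
Variables (n : nat) (i j : 'I_n).
Hypothesis ij : j = i.+1 :> nat.

Definition artin (k : 'I_n) : free_group n :=
  if k == i then fgen j else if k == j then fgen i ^ fgen j else fgen k.

Definition artinV (k : 'I_n) : free_group n :=
  if k == j then fgen i else if k == i then fgen j ^ (fgen i)^-1 else fgen k.

Let neq_ji : (j == i) = false.
Proof. by rewrite -val_eqE /= ij; lia. Qed.

Lemma artinK : cancel (fg_lift artin) (fg_lift artinV).
Proof.
apply: fg_lift_cancel => k; rewrite /artin.
have [->|ki] := eqVneq k i; first by rewrite fg_lift_fgen /artinV eqxx.
have [->|kj] := eqVneq k j; last by rewrite fg_lift_fgen /artinV (negPf ki) (negPf kj).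
by rewrite gmulfJ /= !fg_lift_fgen /artinV eqxx (eq_sym i) neq_ji eqxx conjgKV.
Qed.

Lemma artinVK : cancel (fg_lift artinV) (fg_lift artin).
Proof.
apply: fg_lift_cancel => k; rewrite /artinV.
have [->|kj] := eqVneq k j; first by rewrite fg_lift_fgen /artin eqxx.
have [->|ki] := eqVneq k i; last by rewrite fg_lift_fgen /artin (negPf ki) (negPf kj).
by rewrite gmulfJ gmulfV /= !fg_lift_fgen /artin eqxx neq_ji eqxx conjgK.
Qed.

Lemma artin_tprefix_le k : k <= i -> fg_lift artin (tprefix n k) = tprefix n k.
Proof.
elim: k => [|k IHk] ki; first by rewrite tprefix0 gmulf1.
have kn : k < n by apply: ltn_trans (ltn_ord i).
rewrite tprefixS gmulfM /= IHk ?(ltnW ki) // fg_lift_fgen /artin -!val_eqE /= ij.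
by rewrite !ltn_eqF // ltnW.
Qed.

Lemma artin_tprefixS : fg_lift artin (tprefix n i.+1) = tprefix n i * fgen j.
Proof.
rewrite (tprefixS (ltn_ord i)) gmulfM /= artin_tprefix_le // fg_lift_fgen /artin.
by rewrite -val_eqE eqxx.
Qed.

Lemma artin_tprefix k : k != i.+1 -> k <= n -> fg_lift artin (tprefix n k) = tprefix n k.
Proof.
case: (leqP k i) => [ki _ _|]; first exact: artin_tprefix_le.
elim: k => // k IHk ik ki kn; rewrite (tprefixS kn) gmulfM /= fg_lift_fgen.
have [k_eq | ki2] := eqVneq k i.+1; last first.
  rewrite IHk ?(ltnW kn) //; last by lia.
  by rewrite /artin -!val_eqE /= ij (negPf ki2) -eqSS (negPf ki).
have -> : Ordinal kn = j by apply: val_inj; rewrite /= ij.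
rewrite {1}k_eq artin_tprefixS /artin neq_ji eqxx -mulgA -conjgC mulgA k_eq.
by rewrite (tprefixS (ltn_ord i)); congr (_ * fgen _ * _); apply: val_inj.
Qed.

Lemma braid_artin : braid artin.
Proof.
split.
- by exists artinV; split; [apply: artinK | apply: artinVK].
- by apply: artin_tprefix => //; rewrite -ij neq_ltn ltn_ord orbT.
- exists (tperm i j) => k; rewrite /artin; case: tpermP => [->|->|/eqP ki /eqP kj].
  + by rewrite eqxx; exists 1; rewrite conjg1.
  + by rewrite neq_ji eqxx; exists (fgen j)^-1; rewrite conjgK.
  + by rewrite (negPf ki) (negPf kj); exists 1; rewrite conjg1.
Qed.
End ArtinGenerator.

(* The braid f pulls the puncture b + 1 leftwards, below the punctures a + 1, ..., b. *)
Lemma puncture_pull n a b : a <= b -> b < n -> exists f, [/\ braid f,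
  forall k, k <= n -> (k <= a) || (b < k) -> fg_lift f (tprefix n k) = tprefix n k &
  forall k, a <= k <= b ->
    fg_lift f (tprefix n k) = (tprefix n a * (tprefix n a.+1)^-1 * tprefix n k.+1)%g].
Proof.
move=> /subnKC <-; elim: (b - a) => {b}[|d IHd].
  rewrite addn0 => an; exists (@fgen n); split=> [|k _ _|k ka]; first exact: braid_id.
    by rewrite fg_lift_id.
  have -> : k = a by lia.
  by rewrite fg_lift_id mulgVK.
rewrite addnS; set b := a + d => bn.
have bn' := ltnW bn; have [f [bf f_out f_in]] := IHd bn'.
pose s := artin (Ordinal bn') (Ordinal bn).
have s_fix k : k != b.+1 -> k <= n -> fg_lift s (tprefix n k) = tprefix n k.
  exact: (@artin_tprefix n (Ordinal bn') (Ordinal bn) erefl).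
exists (fg_lift f \o s); split=> [|k kn k_out|k k_in]; rewrite -?fg_lift_comp /=.
- by apply: braid_comp => //; apply: braid_artin.
- by rewrite s_fix ?f_out //; lia.
have [->|kb] := eqVneq k b.+1; last by rewrite s_fix ?f_in //; lia.
rewrite artin_tprefixS // gmulfM /= f_in; last by lia.
have -> : fgen (Ordinal bn) = ((tprefix n b.+1)^-1 * tprefix n b.+2)%g.
  by rewrite (tprefixS bn) mulKg.
by rewrite gmulfM gmulfV /= !f_out ?mulgA ?mulgK //; lia.
Qed.

(** * Meanders *)

Lemma pairwise_cat_cons (T : Type) (r : rel T) x s1 s2 : ssrbool.symmetric r ->
  pairwise r (s1 ++ x :: s2) = all (r x) (s1 ++ s2) && pairwise r (s1 ++ s2).
Proof.
move=> r_sym; rewrite !pairwise_cat allrel_consr /= all_cat.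
rewrite (eq_all (a1 := r^~ x) (fun y => r_sym y x)) -!andbA; do !bool_congr.
Qed.

Lemma pairwise_in (T : eqType) (r : rel T) s :
  uniq s -> {in s &, forall x y, x != y -> r x y} -> pairwise r s.
Proof.
move=> + r_s; rewrite uniq_pairwise; apply: sub_in_pairwise (allss s).
by move=> x y xs ys; apply: r_s.
Qed.

Section Arcs.
Implicit Types (e : nat * nat) (es : seq (nat * nat)) (x y : nat).

Definition ends e := [:: e.1; e.2].

Lemma ends_minmax e x :
  (x \in ends e) = (x == minn e.1 e.2) || (x == maxn e.1 e.2).
Proof. by rewrite !inE; case: leqP; rewrite // orbC. Qed.

Definition width e := maxn e.1 e.2 - minn e.1 e.2.

Definition nest e e' := nested e.1 e.2 e'.1 e'.2.

Lemma between_addb x a b : x != a -> x != b -> between x a b = (a < x) (+) (b < x).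
Proof. by rewrite /between; lia. Qed.

Lemma nestE a b c d : nest (a, b) (c, d) =
  [&& a != b, c != d, a != c, a != d, b != c, b != d & between c a b == between d a b].
Proof. by rewrite /nest /nested /= !inE; lia. Qed.

Lemma nest_sym : ssrbool.symmetric nest.
Proof. by move=> [a b] [c d]; rewrite !nestE /between; lia. Qed.

Lemma nest_mem es e e' :
  pairwise nest es -> e \in es -> e' \in es -> e != e' -> nest e e'.
Proof.
move=> + e_es; case/path.splitPr: e_es => es1 es2.
rewrite pairwise_cat_cons; last exact: nest_sym.
case/andP=> /allP nest_e _ + ne; rewrite mem_cat inE eq_sym (negPf ne) -mem_cat.
exact: nest_e.
Qed.

Lemma nest_disjoint e e' x y : nest e e' -> x \in ends e -> y \in ends e' -> x != y.
Proof.
case: e e' => [a b] [c d]; rewrite nestE !inE => /and5P[_ _ ac ad /and3P[bc bd _]].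
by case/orP=> /eqP-> /orP[]/eqP->.
Qed.

Lemma nest_between e e' x : nest e e' -> x \in ends e' ->
  between x e.1 e.2 -> between e'.1 e.1 e.2 && between e'.2 e.1 e.2.
Proof.
case: e e' => [a b] [c d]; rewrite nestE !inE => /and5P[_ _ _ _ /and3P[_ _ /eqP cd]].
by case/orP=> /eqP-> /=; rewrite cd ?andbb // -cd andbb.
Qed.

Lemma between_width e e' :
  between e'.1 e.1 e.2 -> between e'.2 e.1 e.2 -> width e' < width e.
Proof. by rewrite /between /width; lia. Qed.

Definition pts es := flatten [seq ends e | e <- es].

Lemma ptsP x es : reflect (exists2 e, e \in es & x \in ends e) (x \in pts es).
Proof. exact: flatten_mapP. Qed.

Lemma mem_pts es e : e \in es -> e.1 \in pts es /\ e.2 \in pts es.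
Proof. by move=> e_es; split; apply/ptsP; exists e; rewrite // !inE eqxx ?orbT. Qed.

Lemma minn_pts es e : e \in es -> minn e.1 e.2 \in pts es.
Proof. by move=> e_es; apply/ptsP; exists e; rewrite // ends_minmax eqxx. Qed.

Lemma maxn_pts es e : e \in es -> maxn e.1 e.2 \in pts es.
Proof. by move=> e_es; apply/ptsP; exists e; rewrite // ends_minmax eqxx orbT. Qed.

(* When [es] lists the lower half-arcs in the order in which a path from S to E runs
   through them, these are the upper half-arcs. *)
Fixpoint upper_arcs S es E :=
  if es is e :: es' then (S, e.1) :: upper_arcs e.2 es' E else [:: (S, E)].

Lemma upper_arcs_cat S es1 e es2 E :
  upper_arcs S (es1 ++ e :: es2) E = upper_arcs S es1 e.1 ++ upper_arcs e.2 es2 E.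
Proof. by elim: es1 S => //= e1 es1 IHes S; rewrite IHes. Qed.

Lemma pts_upper_arcs S es E : pts (upper_arcs S es E) = S :: rcons (pts es) E.
Proof. by elim: es S => //= e es IHes S; rewrite /pts /= -/(pts _) IHes. Qed.

Lemma upper_arcs_split S es E e : e \in upper_arcs S es E ->
  [\/ exists q es2, e.1 = S /\ es = (e.2, q) :: es2,
      e.2 = E |
      exists es1 p q es2, es = es1 ++ (p, e.1) :: (e.2, q) :: es2].
Proof.
elim: es S => [|[u v] es IHes] S /=; first by rewrite inE => /eqP->; apply: Or32.
rewrite inE => /predU1P[->|/IHes[[q [es2 [<- ->]]]|->|[es1 [p [q [es2 ->]]]]]].
- by apply: Or31; exists v, es.
- by apply: Or33; exists [::], u, q, es2.
- exact: Or32.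
- by apply: Or33; exists ((u, v) :: es1), p, q, es2.
Qed.

Record meander S E es : Prop := Meander {
  meander_pts : {in pts es, forall x, S < x < E};
  meander_lower : pairwise nest es;
  meander_upper : pairwise nest (upper_arcs S es E) }.

Definition neighbours es p q := {in pts es, forall x, ~~ between x p q}.

Lemma neighbours_sym es p q : neighbours es p q -> neighbours es q p.
Proof. by move=> nbr x /nbr; rewrite /between minnC maxnC. Qed.

Lemma innermost_upper_arc S E es : meander S E es -> 1 < size es ->
  exists es1 p' p q q' es2,
    es = es1 ++ (p', p) :: (q, q') :: es2 /\ neighbours es p q.
Proof.
move=> [es_SE _ upper] es_gt1.
have {es_gt1} [e e_up [Se eE]] : exists2 e : nat * nat,
    e \in upper_arcs S es E & S < e.1 /\ e.2 < E.
  case: es es_gt1 es_SE {upper} => [|[p' p] [|[q q'] es]] // _ es_SE.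
  have /andP[Sp _] : S < p < E by apply: es_SE; rewrite !inE eqxx orbT.
  have /andP[_ qE] : S < q < E by apply: es_SE; rewrite !inE eqxx !orbT.
  by exists (p, q); rewrite // !inE eqxx orbT.
have [d] := ubnP (width e).
elim: d => // d IHd in e e_up Se eE *; rewrite ltnS => e_d.
have [es1 [p' [q' [es2 esE]]]] :
    exists es1 p' q' es2, es = es1 ++ (p', e.1) :: (e.2, q') :: es2.
  by case/upper_arcs_split: e_up => [[? [? [eS _]]]|eE'|//]; lia.
have [/allP e_nbr|/allPn[x x_es /negPn x_e]] :=
  boolP (all (fun x => ~~ between x e.1 e.2) (pts es)).
  by exists es1, p', e.1, e.2, q', es2.
have [e' e'_up x_e'] : exists2 e' : nat * nat, e' \in upper_arcs S es E & x \in ends e'.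
  by apply/ptsP; rewrite pts_upper_arcs inE mem_rcons inE x_es !orbT.
have nest_ee' : nest e e'.
  apply: nest_mem upper e_up e'_up _; apply: contraTneq x_e' => <-.
  by move: x_e; rewrite !inE /between; lia.
have arc1 : (p', e.1) \in es by rewrite esE mem_cat mem_head orbT.
have arc2 : (e.2, q') \in es by rewrite esE mem_cat !inE eqxx !orbT.
have [_ /es_SE/= /andP[_ e1E]] := mem_pts arc1.
have [/es_SE/= /andP[Se2 _] _] := mem_pts arc2.
have /andP[e'1 e'2] := nest_between nest_ee' x_e' x_e.
apply: IHd e'_up _ _ (leq_trans (between_width e'1 e'2) e_d).
- by case/andP: e'1 => + _; apply: ltn_trans; rewrite leq_min Se.
- by case/andP: e'2 => _ /ltn_trans; apply; rewrite gtn_max e1E.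
Qed.
End Arcs.

Section Labellings.
Variable n : nat.
Implicit Types (e : nat * nat) (es : seq (nat * nat)) (c : nat -> nat).

(* [c x] is the number of punctures on the left of the point x of the line. *)
Record labelling es c : Prop := Labelling {
  labelling_mono : {in pts es &, {homo c : x y / x <= y}};
  labelling_le : {in pts es, forall x, c x <= n} }.

Definition arc_word es c : free_group n :=
  (\prod_(e <- es) ((tprefix n (c e.1))^-1 * tprefix n (c e.2)))%g.

Definition span e x := minn e.1 e.2 <= x <= maxn e.1 e.2.

Lemma nest_span e e' : nest e e' -> span e e'.1 = span e e'.2.
Proof.
case: e e' => [a b] [u v]; rewrite nestE => /and5P[_ _ au av /and3P[bu bv /eqP uv]].
by move: uv; rewrite /span /between /=; lia.
Qed.

Definition relabelling es c c' : Prop :=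
  [/\ labelling es c, labelling es c' & braid_orbit (arc_word es c) (arc_word es c')].

Lemma relabelling_refl es c : labelling es c -> relabelling es c c.
Proof. by split=> //; apply: braid_orbit_refl. Qed.

Lemma relabelling_sym es c c' : relabelling es c c' -> relabelling es c' c.
Proof. by case=> lab lab' orb; split=> //; apply: braid_orbit_sym. Qed.

Lemma relabelling_trans es c1 c2 c3 :
  relabelling es c1 c2 -> relabelling es c2 c3 -> relabelling es c1 c3.
Proof.
by case=> lab1 _ orb12 [_ lab3 orb23]; split=> //; apply: braid_orbit_trans orb12 orb23.
Qed.

(* The puncture just right of the half-arc e is carried below e to its left. *)
Lemma arc_word_slide es c c' e : pairwise nest es -> e \in es ->
  labelling es c -> labelling es c' -> {in pts es, forall x, c' x = c x + span e x} ->
  relabelling es c c'.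
Proof.
move=> es_nest e_es lab_c lab_c' c'E; split=> //.
have [c_mono c_le] := lab_c; have [c'_mono c'_le] := lab_c'.
have l_es := minn_pts e_es; have r_es := maxn_pts e_es.
set l := minn _ _ in l_es; set r := maxn _ _ in r_es.
have lr : l <= r by rewrite geq_min leq_maxl.
have r_span : span e r by rewrite /span lr leqnn.
have r_lt : c r < n by have := c'_le _ r_es; rewrite c'E // r_span addn1.
have [f [bf f_out f_in]] := puncture_pull (c_mono _ _ l_es r_es lr) r_lt.
exists f => //; rewrite /arc_word gmulf_prod; apply: eq_big_seq => -[u v] uv_es /=.
have [/= u_es v_es] := mem_pts uv_es.
have span_uv : span e u = span e v.
  have [->|ne] := eqVneq e (u, v); first by rewrite /span /=; lia.
  exact: (nest_span (nest_mem es_nest e_es uv_es ne)).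
pose w := (tprefix n (c l) * (tprefix n (c l).+1)^-1)%g.
have fE x : x \in pts es -> fg_lift f (tprefix n (c x)) =
    if span e x then (w * tprefix n (c x).+1)%g else tprefix n (c x).
  move=> x_es; have [/andP[lx xr]|/negPf x_span] := boolP (span e x).
    by rewrite f_in // !c_mono.
  apply: f_out; first exact: c_le.
  move: (negbT x_span); rewrite negb_and -!ltnNge => /orP[xl|rx].
    by rewrite c_mono // ltnW.
  have := c'_mono _ _ r_es x_es (ltnW rx).
  by rewrite !c'E // r_span x_span addn0 addn1 => ->; rewrite orbT.
rewrite gmulfM gmulfV /= !fE // !c'E // span_uv; case: (span e v); rewrite ?addn0 ?addn1 //.
by rewrite invMg -mulgA mulKg.
Qed.

Lemma slide_left es c e : pairwise nest es -> e \in es -> labelling es c ->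
    c (maxn e.1 e.2) < n ->
    {in pts es, forall x, maxn e.1 e.2 < x -> c (maxn e.1 e.2) < c x} ->
  relabelling es c (fun x => c x + span e x).
Proof.
move=> es_nest e_es lab_c r_lt right_gt; have [c_mono c_le] := lab_c.
apply: (arc_word_slide es_nest e_es) => //.
have r_es := maxn_pts e_es; set r := maxn _ _ in r_es r_lt right_gt.
split=> [x y x_es y_es xy|x x_es]; rewrite /span -/r.
- have := c_mono _ _ x_es y_es xy; have := c_mono _ _ x_es r_es.
  by have := right_gt _ y_es; lia.
- by have := c_le _ x_es; have := c_mono _ _ x_es r_es; lia.
Qed.

Lemma slide_right es c e : pairwise nest es -> e \in es -> labelling es c ->
    0 < c (minn e.1 e.2) ->
    {in pts es, forall x, x < minn e.1 e.2 -> c x < c (minn e.1 e.2)} ->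
  relabelling es c (fun x => c x - span e x).
Proof.
move=> es_nest e_es lab_c l_gt left_lt; have [c_mono c_le] := lab_c.
have l_es := minn_pts e_es; set l := minn _ _ in l_es l_gt left_lt.
apply: relabelling_sym; apply: (arc_word_slide es_nest e_es) => // [|x x_es].
- split=> [x y x_es y_es xy|x x_es]; rewrite /span -/l.
  + have := c_mono _ _ x_es y_es xy; have := c_mono _ _ l_es y_es.
    by have := left_lt _ x_es; lia.
  + by have := c_le _ x_es; lia.
- by have := c_mono _ _ l_es x_es; rewrite /span -/l; lia.
Qed.

Section ClosingGaps.
Variables (es : seq (nat * nat)) (a b : nat) (ea eb : nat * nat).
Hypotheses (es_nest : pairwise nest es) (ea_es : ea \in es) (eb_es : eb \in es).
Hypotheses (nest_ab : nest ea eb) (a_ea : a \in ends ea) (b_eb : b \in ends eb).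
Hypotheses (lt_ab : a < b) (nbr_ab : neighbours es a b).

Let sides x : x \in pts es -> x <= a \/ b <= x.
Proof. by move/nbr_ab; rewrite /between; lia. Qed.

Lemma neighbours_outward : maxn ea.1 ea.2 = a \/ minn eb.1 eb.2 = b.
Proof.
have [ea_max|ne_max] := eqVneq (maxn ea.1 ea.2) a; [by left | right].
have ea_min : minn ea.1 ea.2 = a.
  by move: a_ea; rewrite ends_minmax ![a == _]eq_sym (negPf ne_max) orbF => /eqP.
have a_lt_max : a < maxn ea.1 ea.2.
  by rewrite ltn_neqAle eq_sym ne_max -ea_min geq_min leq_maxl.
have b_lt_max : b < maxn ea.1 ea.2.
  case: (sides (maxn_pts ea_es)) => [|b_le]; first by rewrite leqNgt a_lt_max.
  rewrite ltn_neqAle b_le andbT eq_sym; apply: nest_disjoint nest_ab _ b_eb.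
  by rewrite ends_minmax eqxx orbT.
have b_between : between b ea.1 ea.2 by rewrite /between ea_min lt_ab.
have /andP[/andP[eb1 _] /andP[eb2 _]] := nest_between nest_ab b_eb b_between.
have a_lt_min : a < minn eb.1 eb.2 by rewrite leq_min -ea_min eb1 eb2.
case: (sides (minn_pts eb_es)) => [|b_le]; first by rewrite leqNgt a_lt_min.
apply/eqP; rewrite eqn_leq b_le andbT.
by move: b_eb; rewrite ends_minmax => /orP[]/eqP->; rewrite ?leqnn // geq_min leq_maxl.
Qed.

Lemma narrow_gap c : labelling es c -> c a < c b ->
  exists2 c', relabelling es c c' & c' b - c' a < c b - c a.
Proof.
move=> lab_c lt_c; have [c_mono c_le] := lab_c.
have a_es : a \in pts es by apply/ptsP; exists ea.
have b_es : b \in pts es by apply/ptsP; exists eb.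
have [ea_max|eb_min] := neighbours_outward.
- exists (fun x => c x + span ea x); last by rewrite /span ea_max; lia.
  apply: slide_left; rewrite ?ea_max //; first exact: leq_trans lt_c (c_le _ b_es).
  move=> x x_es; case: (sides x_es) => [xa|bx]; first by rewrite ltnNge xa.
  by move=> _; apply: leq_trans lt_c (c_mono _ _ b_es x_es bx).
- exists (fun x => c x - span eb x); last by rewrite /span eb_min; lia.
  apply: slide_right; rewrite ?eb_min //; first exact: leq_trans lt_c.
  move=> x x_es; case: (sides x_es) => [xa|bx]; last by rewrite ltnNge bx.
  by move=> _; apply: leq_ltn_trans (c_mono _ _ x_es a_es xa) lt_c.
Qed.

Lemma close_gap_lt c : labelling es c -> exists2 c', relabelling es c c' & c' a = c' b.
Proof.
have [d] := ubnP (c b - c a); elim: d c => // d IHd c; rewrite ltnS => c_d lab_c.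
have [eq_c|ne_c] := eqVneq (c a) (c b).
  by exists c => //; apply: relabelling_refl.
have lt_c : c a < c b.
  rewrite ltn_neqAle ne_c; apply: (labelling_mono lab_c) (ltnW lt_ab).
    by apply/ptsP; exists ea.
  by apply/ptsP; exists eb.
have [c1 rel1 narrow1] := narrow_gap lab_c lt_c.
have [_ lab1 _] := rel1; have [c' rel' eq_c'] := IHd c1 (leq_trans narrow1 c_d) lab1.
by exists c' => //; apply: relabelling_trans rel1 rel'.
Qed.
End ClosingGaps.

Lemma close_gap es1 p' p q q' es2 c (es := es1 ++ (p', p) :: (q, q') :: es2) :
    pairwise nest es -> neighbours es p q -> labelling es c ->
  exists2 c', relabelling es c c' & c' p = c' q.
Proof.
move=> es_nest nbr lab_c.
have nest_pq : nest (p', p) (q, q').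
  by move: es_nest; rewrite /es pairwise_cat => /and3P[_ _ /andP[/andP[]]].
have arc_p : (p', p) \in es by rewrite mem_cat mem_head orbT.
have arc_q : (q, q') \in es by rewrite mem_cat !inE eqxx !orbT.
have p_end : p \in ends (p', p) by rewrite !inE eqxx orbT.
have q_end : q \in ends (q, q') by rewrite mem_head.
have := nest_disjoint nest_pq p_end q_end; rewrite neq_ltn => /orP[pq|qp].
  exact: close_gap_lt arc_p arc_q nest_pq p_end q_end pq nbr c lab_c.
have [||c' rel' eq_c'] := close_gap_lt es_nest arc_q arc_p _ q_end p_end qp _ lab_c.
- by rewrite nest_sym.
- exact: neighbours_sym.
by exists c'.
Qed.
End Labellings.

Section Deletion.
Variables (S E : nat) (es1 es2 : seq (nat * nat)) (p' p q q' : nat).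
Let es := es1 ++ (p', p) :: (q, q') :: es2.
Let es' := es1 ++ (p', q') :: es2.

Lemma nest_join e : nest (p', p) (q, q') -> nest (p', p) e -> nest (q, q') e ->
  ~~ between e.1 p q -> ~~ between e.2 p q -> nest (p', q') e.
Proof.
case: e => u v /=; rewrite !nestE.
move=> /and5P[_ _ _ p'q' _] /and5P[_ uv p'u p'v /and3P[pu pv /eqP nest_p]].
move=> /and5P[_ _ qu qv /and3P[q'u q'v /eqP nest_q]] u_pq v_pq.
have between_join x : p' != x -> p != x -> q != x -> q' != x -> ~~ between x p q ->
    between x p' q' = between x p' p (+) between x q q'.
  move=> p'x px qx q'x; rewrite !between_addb 1?eq_sym // negb_add => /eqP->.
  by rewrite addbA addbK.
by rewrite p'q' uv p'u p'v q'u q'v !between_join // nest_p nest_q /=.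
Qed.

Lemma pts_delete : {subset pts es' <= pts es}.
Proof.
move=> x; rewrite /es /es' /pts !map_cat !flatten_cat /= !mem_cat !inE.
by case/or4P=> ->; rewrite ?orbT.
Qed.

Lemma meander_delete : meander S E es -> neighbours es p q -> meander S E es'.
Proof.
move=> [es_SE lower upper] nbr; split; first by move=> x /pts_delete/es_SE.
- move: lower; rewrite /es /es' !(pairwise_cat_cons _ _ _ nest_sym).
  case/and3P=> /allP nest_p /allP nest_q ->; rewrite andbT; apply/allP=> e e_es.
  have [e1 e2] : e.1 \in pts es /\ e.2 \in pts es.
    by apply: mem_pts; move: e_es; rewrite !mem_cat !inE => /orP[]->; rewrite ?orbT.
  apply: nest_join; rewrite ?nest_q ?nbr ?nest_p //.
  + by rewrite mem_cat mem_head orbT.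
  + by move: e_es; rewrite !mem_cat inE => /orP[]->; rewrite ?orbT.
- move: upper; rewrite !upper_arcs_cat /=; apply: subseq_pairwise.
  exact: cat_subseq (subseq_refl _) (subseq_cons _ _).
Qed.
End Deletion.

Section MeanderOrbit.
Variable n : nat.
Implicit Types (es : seq (nat * nat)) (c : nat -> nat).

Lemma labelling_sub es es' c : {subset pts es' <= pts es} ->
  labelling n es c -> labelling n es' c.
Proof.
move=> sub [c_mono c_le]; split=> [x y /sub x_es /sub y_es|x /sub].
  exact: c_mono.
exact: c_le.
Qed.

Lemma arc_word_delete c es1 es2 p' p q q' : c p = c q ->
  arc_word n (es1 ++ (p', p) :: (q, q') :: es2) c = arc_word n (es1 ++ (p', q') :: es2) c.
Proof. by move=> cpq; rewrite /arc_word !big_cat !big_cons /= cpq !mulgA mulgK. Qed.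

Lemma single_arc_lt S E x y : meander S E [:: (x, y)] -> x < y.
Proof.
move=> [xy_SE _ /=].
have /andP[Sx xE] : S < x < E by apply: xy_SE; rewrite !inE eqxx.
have /andP[Sy yE] : S < y < E by apply: xy_SE; rewrite !inE eqxx orbT.
by rewrite !andbT nestE /between; lia.
Qed.

Lemma single_arc_orbit c x y : x < y -> labelling n [:: (x, y)] c ->
  exists2 k, k <= n & braid_orbit (arc_word n [:: (x, y)] c) (tprefix n k).
Proof.
move=> xy; have [m] := ubnP (c x); elim: m c => // m IHm c cx_m lab_c.
have [_ /(_ y) cy_le] := lab_c.
have [cx0|cx_gt] := posnP (c x).
  exists (c y); first by apply: cy_le; rewrite !inE eqxx orbT.
  rewrite /arc_word big_seq1 /= cx0 tprefix0 invg1 mul1g; exact: braid_orbit_refl.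
have min_xy : minn x y = x by apply/minn_idPl/ltnW.
have [||_ lab_c' orb] :=
  slide_right (es := [:: (x, y)]) isT (mem_head (x, y) [::]) lab_c; rewrite /= ?min_xy //.
  by move=> z; rewrite !inE => /orP[]/eqP->; rewrite ?ltnn // ltnNge ltnW.
have [|k kn k_orb] := IHm _ _ lab_c'.
  by rewrite /span /= min_xy leqnn leq_maxl; lia.
by exists k => //; apply: braid_orbit_trans orb k_orb.
Qed.

Lemma meander_orbit S E es c : meander S E es -> labelling n es c ->
  exists2 k, k <= n & braid_orbit (arc_word n es c) (tprefix n k).
Proof.
have [m] := ubnP (size es); elim: m => // m IHm in es c *.
rewrite ltnS => es_m es_meander lab_c.
case: (ltnP 1 (size es)) => [es_gt1|].
  have [es1 [p' [p [q [q' [es2 [esE nbr]]]]]]] := innermost_upper_arc es_meander es_gt1.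
  rewrite {}esE in es_m es_meander lab_c nbr *.
  have [c' [_ lab_c' orb] eq_c'] := close_gap (meander_lower es_meander) nbr lab_c.
  have [||k kn k_orb] := IHm _ c' _ (meander_delete es_meander nbr).
  + by apply: leq_trans es_m; rewrite !size_cat /= !addnS ltnS.
  + exact: labelling_sub (@pts_delete _ _ _ _ _ _) lab_c'.
  by exists k => //; apply: braid_orbit_trans orb _; rewrite arc_word_delete.
case: es es_meander lab_c {es_m} => [|[x y] [|//]] es_meander lab_c _.
  exists 0 => //; rewrite /arc_word big_nil tprefix0; exact: braid_orbit_refl.
exact: single_arc_orbit (single_arc_lt es_meander) lab_c.
Qed.
End MeanderOrbit.

(** * Planar words *)

Lemma nested_consecutive k l : k.+1 < l \/ l.+1 < k -> nested k k.+1 l l.+1.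
Proof. by rewrite -[nested _ _ _ _]/(nest (_, _) (_, _)) nestE /between; lia. Qed.

Lemma planar_seq_sorted c : sorted leq c -> planar_seq c.
Proof.
move=> c_sorted; exists (iota 0 (size c)).
have id_iota i : i < size c -> nth 0 (iota 0 (size c)) i = i.
  by move=> i_c; rewrite nth_iota.
split=> [//|i j i_c j_c|i j i_c j_c ij|i j i_c j_c ij].
- rewrite !id_iota // => /ltnW.
  exact: (sorted_leq_nth leq_trans leqnn).
- by rewrite !id_iota; [apply: nested_consecutive | ..]; lia.
- by rewrite !id_iota; [apply: nested_consecutive | ..]; lia.
Qed.

Definition lower_arcs (x : nat -> nat) m := [seq (x i.*2.+1, x i.*2.+2) | i <- iota 0 m].

Lemma upper_lower_arcs x m :
  upper_arcs (x 0) (lower_arcs x m) (x m.*2.+1) =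
  [seq (x i.*2, x i.*2.+1) | i <- iota 0 m.+1].
Proof.
suff arcs_from k : upper_arcs (x k.*2) [seq (x i.*2.+1, x i.*2.+2) | i <- iota k m]
    (x (k + m).*2.+1) = [seq (x i.*2, x i.*2.+1) | i <- iota k m.+1].
  exact: (arcs_from 0).
elim: m k => [|m IHm] k /=; first by rewrite addn0.
by rewrite -addSnnS -doubleS IHm.
Qed.

Lemma pts_lower_arcs x m y : y \in pts (lower_arcs x m) ->
  exists2 k, 0 < k < m.*2.+1 & y = x k.
Proof.
case/ptsP=> e /mapP[i]; rewrite mem_iota => /andP[_ im] ->; rewrite !inE.
by case/orP=> /eqP->; [exists i.*2.+1|exists i.*2.+2] => //=; lia.
Qed.

Section WhiteheadExpansion.
Variable n : nat.
Implicit Types (a : letter n) (w : word n).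

Lemma code_bounds a : 0 < code a < n.*2.+1.
Proof. by rewrite /code; have := ltn_ord a.1; case: a.2 => /=; lia. Qed.

Lemma tprefix_code a :
  ((tprefix n (code a)./2)^-1 * tprefix n (code (linv a))./2)%g = of_word [:: a].
Proof.
case: a => -[j jn] [] /=; rewrite /code /= ?doubleK uphalf_double (tprefixS jn).
  by rewrite invMg mulgVK -of_wordV.
by rewrite mulKg.
Qed.

Lemma size_wh_exp w : size (wh_exp w) = (size w).+1.*2.
Proof.
rewrite /= size_cat size_flatten /shape -map_comp addn1 /=.
by elim: w => //= a w IHw; lia.
Qed.

Lemma nth_wh_exp w (i : 'I_(size w)) (a := tnth (in_tuple w) i) :
  nth 0 (wh_exp w) i.*2.+1 = code a /\ nth 0 (wh_exp w) i.*2.+2 = code (linv a).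
Proof.
suff nth_wh a0 j : j < size w -> nth 0 (wh_exp w) j.*2.+1 = code (nth a0 w j) /\
    nth 0 (wh_exp w) j.*2.+2 = code (linv (nth a0 w j)).
  by rewrite {}/a; set a := tnth _ _; rewrite [a](tnth_nth a); apply: nth_wh.
by rewrite /wh_exp /=; elim: w j {i a} => // b w IHw [|j] //= /IHw.
Qed.

Lemma nth_wh_exp_last w : nth 0 (wh_exp w) (size w).*2.+1 = n.*2.+1.
Proof. by rewrite /wh_exp /=; elim: w. Qed.

Lemma wh_exp_inner w k : 0 < k < (size w).*2.+1 -> 0 < nth 0 (wh_exp w) k < n.*2.+1.
Proof.
move=> kw; have iw : k.-1./2 < size w by lia.
have [odd_k even_k] := nth_wh_exp (Ordinal iw).
have [->|->] : k = k.-1./2.*2.+1 \/ k = k.-1./2.*2.+2 by lia.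
  by rewrite odd_k code_bounds.
by rewrite even_k code_bounds.
Qed.

Lemma wh_exp_tprod k : k <= n -> wh_exp (tprod n k) = rcons (iota 0 k.*2.+1) n.*2.+1.
Proof.
move=> kn; rewrite /wh_exp cats1 -rcons_cons /=; congr (rcons (0 :: _) _).
elim: k kn => [|k IHk] kn; first by rewrite /tprod take0.
rewrite tprod_rcons map_rcons flatten_rcons IHk ?(ltnW kn) // doubleS -addn2 iotaD.
by rewrite /code /= add1n.
Qed.

Lemma planar_tprod k : k <= n -> planar (tprod n k).
Proof.
move=> kn; rewrite /planar reduce_id ?reduced_tprod //.
apply: planar_seq_sorted; rewrite wh_exp_tprod //.
rewrite (sorted_pairwise leq_trans) pairwise_rcons -(sorted_pairwise leq_trans) iota_sorted.
by rewrite andbT; apply/allP=> i; rewrite mem_iota; lia.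
Qed.

Section PlanarPermutation.
Variables (w : word n) (s : seq nat).
Let m := size w.
Let symbols := wh_exp w.
Let pi := nth 0 s.
Hypothesis s_perm : perm_eq s (iota 0 m.+1.*2).
Hypothesis pi_mono : forall i j, i < m.+1.*2 -> j < m.+1.*2 -> pi i < pi j ->
  nth 0 symbols i <= nth 0 symbols j.
Hypothesis pi_upper : forall i j, i < m.+1 -> j < m.+1 -> i != j ->
  nested (pi i.*2) (pi i.*2.+1) (pi j.*2) (pi j.*2.+1).
Hypothesis pi_lower : forall i j, i.+1 < m.+1 -> j.+1 < m.+1 -> i != j ->
  nested (pi i.*2.+1) (pi i.*2.+2) (pi j.*2.+1) (pi j.*2.+2).

Let s_uniq : uniq s. Proof. by rewrite (perm_uniq s_perm) iota_uniq. Qed.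
Let s_size : size s = m.+1.*2. Proof. by rewrite (perm_size s_perm) size_iota. Qed.

Let pi_lt i j : i < m.+1.*2 -> j < m.+1.*2 ->
  nth 0 symbols i < nth 0 symbols j -> pi i < pi j.
Proof.
move=> i_m j_m lt_sym; rewrite ltnNge leq_eqVlt negb_or nth_uniq ?s_size //.
apply/andP; split; first by apply: contraTneq lt_sym => ->; rewrite ltnn.
by apply: contraTN lt_sym => /pi_mono-/(_ j_m i_m); rewrite leqNgt.
Qed.

Lemma planar_meander : meander (pi 0) (pi m.*2.+1) (lower_arcs pi m).
Proof.
split=> [x /pts_lower_arcs[k km ->]||].
- have /andP[sym_gt sym_lt] := wh_exp_inner km.
  by apply/andP; split; apply: pi_lt; rewrite // /symbols ?nth_wh_exp_last; lia.
- rewrite pairwise_map; apply: pairwise_in (iota_uniq _ _) _ => i j.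
  by rewrite !mem_iota; apply: pi_lower.
- rewrite upper_lower_arcs pairwise_map; apply: pairwise_in (iota_uniq _ _) _ => i j.
  by rewrite !mem_iota; apply: pi_upper.
Qed.

(* A point carrying the symbol t_j or tbar_(j-1) has j - 1 punctures on its left. *)
Definition planar_label x := (nth 0 symbols (index x s))./2.

Lemma planar_labelE i : i < m.+1.*2 -> planar_label (pi i) = (nth 0 symbols i)./2.
Proof. by move=> i_m; rewrite /planar_label index_uniq ?s_uniq ?s_size. Qed.

Lemma planar_labelling : labelling n (lower_arcs pi m) planar_label.
Proof.
split=> [x y /pts_lower_arcs[i im ->] /pts_lower_arcs[j jm ->]|x /pts_lower_arcs[i im ->]].
- rewrite leq_eqVlt => /predU1P[-> //|lt_pi].
  by rewrite !planar_labelE; try lia; apply: half_leq; apply: pi_mono lt_pi; lia.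
- by have := wh_exp_inner im; rewrite -/symbols planar_labelE; lia.
Qed.

Lemma planar_arc_word : arc_word n (lower_arcs pi m) planar_label = of_word w.
Proof.
rewrite of_word_prod big_tnth /arc_word big_map.
rewrite -[X in iota 0 X]subn0 -/(index_iota 0 m) big_mkord.
apply: eq_bigr => i _; have im := ltn_ord i; have [odd_i even_i] := nth_wh_exp i.
by rewrite /= !planar_labelE ?odd_i ?even_i ?tprefix_code // -/m; lia.
Qed.
End PlanarPermutation.

Lemma planar_orbit w : planar_seq (wh_exp w) ->
  exists2 k, k <= n & braid_orbit (of_word w) (tprefix n k).
Proof.
rewrite /planar_seq size_wh_exp -muln2 mulnK // muln2.
case=> s [s_perm pi_mono pi_upper pi_lower].
rewrite -(planar_arc_word s_perm).
exact: meander_orbit (planar_meander s_perm pi_mono pi_upper pi_lower)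
                     (planar_labelling s_perm pi_mono).
Qed.
End WhiteheadExpansion.

Theorem theoremA (n : nat) :
  (forall k, k <= n -> planar (tprod n k)) /\
  (forall w : word n, reduced w -> planar w ->
     exists! k, k <= n /\ in_Bn_orbit w (tprod n k)).
Proof.
split=> [|w rw]; first exact: planar_tprod.
rewrite /planar reduce_id // => /planar_orbit[k kn w_k].
exists k; split; first by split=> //; apply/in_Bn_orbitP; first exact: reduced_tprod.
move=> l [ln /(in_Bn_orbitP _ (reduced_tprod n l)) w_l].
exact: tprefix_orbit_inj kn ln w_k w_l.
Qed.
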